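(* Let $e$ be a loop in a finite graph $G$ (so $G-e=G/e$). Then: (a) There is a short exact sequence of chain maps \[0\to C^{i-1}(G/e)\otimes B\xrightarrow{\alpha}C^i(G)\xrightarrow{\beta}C^i(G-e)\to 0,\] where $\alpha$ maps each summand $C^s(G/e)\otimes B$ isomorphically onto $C^{s\cup\{e\}}(G)$ via the natural identification ($[G:s\cup\{e\}]$ is obtained from $[G/e:s]$ by adding the loop $e$), and $\beta$ kills the summands $C^s(G)$ with $e\in s$ and is the identity $C^s(G)=C^s(G-e)$ on summands with $e\notin s$. (b) This induces a long exact sequence \[0\to H^0(G)\xrightarrow{\beta^*}H^0(G-e)\xrightarrow{\gamma^*}H^0(C(G/e)\otimes B)\xrightarrow{\alpha^*}H^1(G)\xrightarrow{\beta^*}H^1(G-e)\xrightarrow{\gamma^*}H^1(C(G/e)\otimes B)\xrightarrow{\alpha^*}\cdots\]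
   Context: Graphs are finite, loops and multiple edges allowed; $E(G-e)=E(G/e)$ is identified with $E(G)\setminus\{e\}$. $A=\mathbb{Z}[x]/(x^2)$, $B=\mathbb{Z}[y]/(y^2)$, bigraded with $\deg x=(1,0)$, $\deg y=(0,1)$. For a graph $G$ with ordered edges $e_1,\dots,e_n$ and $s\subseteq E(G)$, $[G:s]$ is the spanning subgraph with edge set $s$, with $b_0(s)$ components and first Betti number $b_1(s)$; $C^s(G)=A^{\otimes b_0(s)}\otimes B^{\otimes b_1(s)}$ (one $A$ factor per component), $C^i(G)=\bigoplus_{|s|=i}C^s(G)$. For $e_j\notin s$, the per-edge map $d_{s,j}:C^s(G)\to C^{s\cup\{e_j\}}(G)$ multiplies the $A$ factors of the two components joined by $e_j$ if they are distinct (identity elsewhere), and otherwise is the identity on the $A$ factors and $b\mapsto b\otimes 1$ on $B^{\otimes b_1(s)}$. The differential is $d^i=\sum_{|s|=i}\sum_{e_j\notin s}(-1)^{|\{k<j:e_k\in s\}|}d_{s,j}$; $H^i(G)$ is its cohomology. The complex $C(G/e)\otimes B$ has $i$-th chain group $C^i(G/e)\otimes B=\bigoplus_{|s|=i}C^s(G/e)\otimes B$ and differential with the same signs and per-edge maps $C^s(G/e)\otimes B\to C^{s\cup\{f\}}(G/e)\otimes B$ defined as: if $f$ joins two different components of $[G/e:s]$, multiply their $A$ factors (identity elsewhere, including the extra $B$); if $f$ joins a component of $[G/e:s]$ to itself, use the natural isomorphism $C^{s\cup\{f\}}(G/e)\otimes B\cong (C^s(G/e)\otimes B)\otimes B$ and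 send $z\mapsto z\otimes 1$. (This differential is not $d_{C(G/e)}\otimes \mathrm{Id}_B$.)
   Formalization: On the summand of s, α is the natural identification times (−1)^{number of edges of s after e}; without this sign α is not a chain map unless e is the last edge, in which case the sign is 1. *)

(* Defs.v *)
From HB Require Import structures.
From mathcomp Require Import all_boot all_order all_algebra.
From mathcomp Require Import boolp.

Set Implicit Arguments.
Unset Strict Implicit.
Unset Printing Implicit Defensive.

Import Order.TTheory GRing.Theory Num.Theory.
Local Open Scope ring_scope.

(* The edges are labels in 'I_n, ordered as natural numbers.  Keeping the edge
   set as a subset of 'I_n makes E(G - e) = E(G / e) = E(G) \ {e} hold literally,
   with the induced order.  The value of [gends] outside [gedge] is irrelevant. *)
Record mgraph (T : finType) (n : nat) := MGraph {
  gvert : {set T};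
  gedge : {set 'I_n};
  gends : {ffun 'I_n -> T * T};
  gendsP : [forall f in gedge,
              ((gends f).1 \in gvert) && ((gends f).2 \in gvert)]
}.

Section Graphs.
Variables (T : finType) (n : nat).
Implicit Types (G : mgraph T n) (s : {set 'I_n}) (e f : 'I_n).

Definition is_loop G e : bool := (gends G e).1 == (gends G e).2.

Lemma gdel_subproof G e :
  [forall f in gedge G :\ e,
     ((gends G f).1 \in gvert G) && ((gends G f).2 \in gvert G)].
Proof.
apply/forall_inP => f /setD1P[_ fG]; exact: (forall_inP (gendsP G)).
Qed.

Definition gdel G e : mgraph T n := MGraph (gdel_subproof G e).

(* Contraction moves the second endpoint of e onto the first one. *)
Definition contract_vertex G e (v : T) : T :=
  if v == (gends G e).2 then (gends G e).1 else v.

Definition contract_ends G e : {ffun 'I_n -> T * T} :=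
  [ffun f => (contract_vertex G e (gends G f).1,
              contract_vertex G e (gends G f).2)].

Lemma gcontract_subproof G e :
  [forall f in gedge G :\ e,
     ((contract_ends G e f).1 \in contract_vertex G e @: gvert G) &&
     ((contract_ends G e f).2 \in contract_vertex G e @: gvert G)].
Proof.
apply/forall_inP => f /setD1P[_ fG]; rewrite ffunE /=.
by have /andP[u_G v_G] := forall_inP (gendsP G) f fG; rewrite !imset_f.
Qed.

Definition gcontract G e : mgraph T n := MGraph (gcontract_subproof G e).

Definition sub_adj G s : rel T :=
  fun u v => [exists f in s, (gends G f == (u, v)) || (gends G f == (v, u))].

(* The components of the spanning subgraph [G : s], as sets of vertices. *)
Definition comps G s : {set {set T}} :=
  equivalence_partition (connect (sub_adj G s)) (gvert G).

Definition b0 G s : nat := #|comps G s|.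
(* Euler's formula; since |V| <= |s| + b0(s), the subtraction never truncates. *)
Definition b1 G s : nat := #|s| + b0 G s - #|gvert G|.

Definition joins_distinct G s f : bool :=
  ~~ connect (sub_adj G s) (gends G f).1 (gends G f).2.

End Graphs.

(* The homomorphism Z^I -> Z^J sending the basis vector i to
   the sum over j of (M i j) times the basis vector j. *)
Definition lin_ext (I J : finType) (M : I -> J -> int) (z : {ffun I -> int}) :
  {ffun J -> int} := [ffun j => \sum_i z i * M i j].

Lemma lin_ext_is_additive (I J : finType) (M : I -> J -> int) :
  zmod_morphism (lin_ext M).
Proof.
move=> z w; apply/ffunP => j; rewrite !ffunE -sumrB.
by apply: eq_bigr => i _; rewrite !ffunE mulrBl.
Qed.

HB.instance Definition _ (I J : finType) (M : I -> J -> int) :=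
  GRing.isZmodMorphism.Build {ffun I -> int} {ffun J -> int} (lin_ext M)
    (lin_ext_is_additive M).

Section Chains.
Variables (T : finType) (n : nat).
Implicit Types (G H : mgraph T n) (s : {set 'I_n}) (e f : 'I_n).

Definition component G s := {K : {set T} | K \in comps G s}.
HB.instance Definition _ G s := Finite.on (component G s).

(* A = Z[x]/(x^2) has basis {1, x} and B = Z[y]/(y^2) has basis {1, y}; in both
   cases false stands for 1 and true for the variable.  Hence a basis of
   C^s(G), i.e. A tensored over the components of [G : s] and B tensored b1(s)
   times, consists of the pairs made of an exponent of x for each component and
   of a list of b1(s) exponents of y. *)
Definition mono G s : finType :=
  ({ffun component G s -> bool} * (b1 G s).-tuple bool)%type.

(* The basis of C^i(G), the direct sum of the C^s(G) for s of size i. *)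
Definition cbasis G (i : nat) : finType :=
  {t : {s : {set 'I_n} & mono G s}
     | (tag t \subset gedge G) && (#|tag t| == i)}.

Definition chain G (i : nat) : zmodType := {ffun cbasis G i -> int}.

Definition chainB G (i : nat) : zmodType :=
  {ffun (cbasis G i * bool)%type -> int}.

Section Basis.
Variables (G : mgraph T n) (i : nat).
Implicit Types (t : cbasis G i).
Definition supp t : {set 'I_n} := tag (val t).
Definition xexp t : {ffun component G (supp t) -> bool} := (tagged (val t)).1.
Definition yexp t : seq bool := (tagged (val t)).2.
End Basis.

(* For s included in s', [m'] is the product of the A factors of [m] along the
   map from the components of [G : s] to those of [G : s'].  Exponents add up,
   and no m' satisfies the equation when some exponent would be at least 2: this
   is x^2 = 0.  A component of [G : s'] which is also a component of [G : s]
   keeps its factor. *)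
Definition merge_A G s s' (m : {ffun component G s -> bool})
    (m' : {ffun component G s' -> bool}) : bool :=
  [forall c' : component G s',
     (\sum_(c : component G s | val c \subset val c') m c == m' c' :> nat)%N].

(* Coefficient (0 or 1) of the basis vector t' in the image of the basis vector
   t under d_(s,f), where s is the support of t. *)
Definition edge_coef G i (f : 'I_n) (t : cbasis G i) (t' : cbasis G i.+1) :
    bool :=
  [&& supp t' == f |: supp t, merge_A (xexp t) (xexp t')
    & yexp t' == if joins_distinct G (supp t) f then yexp t
                 else rcons (yexp t) false].

(* The same for C(G) tensored with B.  The extra B factor comes last, so that
   the list of all the B factors is [rcons (yexp t) b]; the natural isomorphism
   between C^(s+f)(G) (x) B and (C^s(G) (x) B) (x) B is the identity on these
   lists. *)
Definition edge_coefB G i (f : 'I_n) (t : cbasis G i * bool)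
    (t' : cbasis G i.+1 * bool) : bool :=
  [&& supp t'.1 == f |: supp t.1, merge_A (xexp t.1) (xexp t'.1)
    & if joins_distinct G (supp t.1) f
      then (yexp t'.1 == yexp t.1) && (t'.2 == t.2)
      else rcons (yexp t'.1) t'.2 == rcons (rcons (yexp t.1) t.2) false].

Definition edge_sign s f : int := (-1) ^+ #|[set k in s | (k < f)%N]|.

Definition diff_coef G i (t : cbasis G i) (t' : cbasis G i.+1) : int :=
  \sum_(f in gedge G | f \notin supp t)
     edge_sign (supp t) f * (edge_coef f t t')%:R.

Definition diff G i : {additive chain G i -> chain G i.+1} :=
  lin_ext (@diff_coef G i).

Definition diffB_coef G i (t : cbasis G i * bool) (t' : cbasis G i.+1 * bool) :
    int :=
  \sum_(f in gedge G | f \notin supp t.1)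
     edge_sign (supp t.1) f * (edge_coefB f t t')%:R.

Definition diffB G i : {additive chainB G i -> chainB G i.+1} :=
  lin_ext (@diffB_coef G i).

(* The natural identification of C^s(G / e) (x) B with C^(s+e)(G): a component
   of [G / e : s] and the component of [G : s + e] with the same vertices carry
   the same A factor, and the extra B factor becomes the last B factor. *)
Definition alpha_coef G e i (t : cbasis (gcontract G e) i * bool)
    (t' : cbasis G i.+1) : bool :=
  [&& supp t' == e |: supp t.1,
      [forall c, forall c', (val c == val c') ==> (xexp t.1 c == xexp t' c')]
    & yexp t' == rcons (yexp t.1) t.2].

(* Adding e to s changes the sign attached to every edge larger than e.  The
   factor below makes alpha commute with the differentials whatever the position
   of e in the ordering; it is 1 when e is the last edge. *)
Definition alpha_sign s e : int := (-1) ^+ #|[set k in s | (e < k)%N]|.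

Definition alpha G e i :
    {additive chainB (gcontract G e) i -> chain G i.+1} :=
  lin_ext (fun t t' => alpha_sign (supp t.1) e * (alpha_coef t t')%:R).

(* [mono (gdel G e) s] is convertible to [mono G s], so that basis vectors of
   C(G) and of C(G - e) can be compared.  A basis vector of C(G) whose support
   contains e is equal to none of C(G - e), hence is sent to 0. *)
Definition beta G e i : {additive chain G i -> chain (gdel G e) i} :=
  lin_ext (fun (t : cbasis G i) (t' : cbasis (gdel G e) i) =>
    (val t == (val t' : {s : {set 'I_n} & mono G s}))%:R).

Definition in_summand G i s (z : chain G i) : Prop :=
  forall t, supp t != s -> z t = 0.

Definition in_summandB G i s (z : chainB G i) : Prop :=
  forall t, supp t.1 != s -> z t = 0.

End Chains.

Definition is_complex (C : nat -> zmodType)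
    (d : forall i, {additive C i -> C i.+1}) : Prop :=
  forall i z, d i.+1 (d i z) = 0.

Definition exact_at (U V W : zmodType) (f : U -> V) (g : V -> W) : Prop :=
  forall v, g v = 0 <-> exists u, v = f u.

Section Cohomology.
Variables (C : nat -> zmodType) (d : forall i, {additive C i -> C i.+1}).

Definition cocycle_pred i : {pred C i} := fun z => d i z == 0.

Lemma cocycle_pred_zmod_closed i : zmod_closed (@cocycle_pred i).
Proof.
split=> [|z w]; rewrite !unfold_in /= ?raddf0 // => /eqP dz /eqP dw.
by rewrite raddfB dz dw subr0.
Qed.

HB.instance Definition _ i :=
  GRing.isZmodClosed.Build (C i) (@cocycle_pred i)
    (@cocycle_pred_zmod_closed i).

Definition cocycle i := {z : C i | z \in @cocycle_pred i}.
HB.instance Definition _ i := SubChoice.on (cocycle i).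
HB.instance Definition _ i := [SubChoice_isSubZmodule of cocycle i by <:].

(* The chain group in degree -1 is zero. *)
Definition is_coboundary i : C i -> Prop :=
  match i return C i -> Prop with
  | 0 => fun z => z = 0
  | j.+1 => fun z => exists w : C j, z = d j w
  end.

Definition coboundary_pred i : {pred cocycle i} :=
  fun z => `[< is_coboundary (val z) >].

Lemma coboundary_pred_zmod_closed i : zmod_closed (@coboundary_pred i).
Proof.
split=> [|z w]; rewrite !unfold_in /=.
  by apply/asboolP; case: i => //= i; exists 0; rewrite raddf0.
move=> /asboolP zB /asboolP wB; apply/asboolP.
case: i z w zB wB => /= [z w -> ->|i z w [z' ->] [w' ->]]; first by rewrite subr0.
by exists (z' - w'); rewrite raddfB.
Qed.

HB.instance Definition _ i :=
  GRing.isZmodClosed.Build (cocycle i) (@coboundary_pred i)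
    (@coboundary_pred_zmod_closed i).

Definition cohom i : zmodType := Quotient.quot (@coboundary_pred i).

Definition cohom_class i (z : cocycle i) : cohom i :=
  (\pi_(Quotient.quot (@coboundary_pred i)) z)%qT.

End Cohomology.

(* Main.v *)
Require Import Defs.
From HB Require Import structures.
From mathcomp Require Import all_boot all_order all_algebra.
From mathcomp Require Import boolp.

Set Implicit Arguments.
Unset Strict Implicit.
Unset Printing Implicit Defensive.

Import Order.TTheory GRing.Theory Num.Theory.
Local Open Scope ring_scope.

(* Since e is a loop, G - e = G / e and [G : s + e] has the same components as
   [G : s] and one more independent cycle.  Hence basis vectors of C(G) whose
   support avoids e are those of C(G - e), and those whose support contains e
   correspond to those of C(G / e) (x) B: alpha and beta are given by injections
   between bases, up to sign.  For d^2 = 0, the composite of the maps of edges f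
   and g merges factors along [G : s] -> [G : s + f + g] and appends 1's in B,
   hence does not depend on the order of f and g, while the signs are opposite. *)

(** Independence of the order of f and g is delicate because of x^2 = 0: with x on two components
    joined by f, one order kills the term at once, while the other may first merge one of them with
    a third component and kill it only at the second step. Since exponents only add up, an excess in
    an intermediate component persists in the final graph, so vanishing can be tested there. The
    other obstacle is that exponents are indexed by the components of [G : s], a type that depends
    on s. Basis vectors are therefore compared through functions on all vertex sets and plain lists,
    and the bijection behind [alpha] is handled as a relation. The initial 0 of the long exact
    sequence comes from degree 0, where no support contains e and [beta] is injective. *)

(** * Cohomology classes and maps induced on them *)

Section CohomologyClasses.
Variables (C : nat -> zmodType) (d : forall i, {additive C i -> C i.+1}).

Lemma cocycleP i (z : cocycle d i) : d i (val z) = 0.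
Proof. by case: z => z /= /eqP. Qed.

Lemma mk_cocycle i (z : C i) : d i z = 0 -> exists w : cocycle d i, val w = z.
Proof. by move=> /eqP dz; exists (Sub z dz). Qed.

Lemma cohom_class_eq i (z w : cocycle d i) :
  cohom_class z = cohom_class w <-> is_coboundary d (val z - val w).
Proof.
rewrite /cohom_class; split.
  by move/eqP; rewrite -Quotient.idealrBE unfold_in => /asboolP.
by move=> zw; apply/eqP; rewrite -Quotient.idealrBE unfold_in; apply/asboolP.
Qed.

Lemma cohom_classB i : {morph @cohom_class C d i : z w / z - w}.
Proof. by move=> z w; rewrite /cohom_class raddfB. Qed.

Lemma cohom_class_eq0 i (z : cocycle d i) :
  cohom_class z = 0 <-> is_coboundary d (val z).
Proof.
have -> : 0 = cohom_class (0 : cocycle d i) by rewrite /cohom_class raddf0.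
by rewrite cohom_class_eq subr0.
Qed.

Lemma cohom_classW i (P : cohom d i -> Prop) :
  (forall z, P (cohom_class z)) -> forall x, P x.
Proof. by move=> Pc x; rewrite -[x]reprK; apply: Pc. Qed.

Lemma coboundary0 i : is_coboundary d (0 : C i).
Proof. by case: i => //= i; exists 0; rewrite raddf0. Qed.

End CohomologyClasses.

(** The connecting homomorphism is defined by choices, hence by a relation rather than by a chain
    map. Closure under differences reduces both independence of the choices and additivity to the
    condition on coboundaries. *)
Lemma cohom_map_of_rel (C D : nat -> zmodType)
    (dC : forall i, {additive C i -> C i.+1})
    (dD : forall i, {additive D i -> D i.+1}) i j
    (R : cocycle dC i -> cocycle dD j -> Prop) :
    (forall z, exists w, R z w) ->
    (forall z w z' w', R z w -> R z' w' -> R (z - z') (w - w')) ->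
    (forall z w, R z w -> is_coboundary dC (val z) -> is_coboundary dD (val w)) ->
  exists F : {additive cohom dC i -> cohom dD j},
    forall z w, R z w -> F (cohom_class z) = cohom_class w.
Proof.
move=> totR subR bndR.
pose F (x : cohom dC i) := cohom_class (sval (cid (totR (repr x)))).
have FE z w : R z w -> F (cohom_class z) = cohom_class w.
  move=> Rzw; rewrite /F; case: cid => w' /= Rw'.
  apply/cohom_class_eq; apply: bndR (subR _ _ _ _ Rw' Rzw) _.
  by apply/cohom_class_eq; rewrite [LHS]reprK.
have F_additive : zmod_morphism F.
  elim/cohom_classW => z; elim/cohom_classW => z'.
  have [[w Rw] [w' Rw']] := (totR z, totR z').
  rewrite -cohom_classB (FE _ _ (subR _ _ _ _ Rw Rw')).
  by rewrite (FE _ _ Rw) (FE _ _ Rw') cohom_classB.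
pose hF := GRing.isZmodMorphism.Build _ _ F F_additive.
pose aF : {additive _ -> _} := HB.pack F hF.
by exists aF.
Qed.

(** * The long exact sequence, with [a] raising the degree by one *)

Section LongExactSequence.
Variables (C D E : nat -> zmodType).
Variables (dC : forall i, {additive C i -> C i.+1}).
Variables (dD : forall i, {additive D i -> D i.+1}).
Variables (dE : forall i, {additive E i -> E i.+1}).
Variables (a : forall i, {additive C i -> D i.+1}).
Variables (b : forall i, {additive D i -> E i}).
Hypotheses (dDD : is_complex dD).
Hypothesis da : forall i z, dD i.+1 (a i z) = a i.+1 (dC i z).
Hypothesis db : forall i z, dE i (b i z) = b i.+1 (dD i z).
Hypotheses (b0_inj : injective (b 0)) (a_inj : forall i, injective (a i)).
Hypothesis ab_exact : forall i, exact_at (a i) (b i.+1).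
Hypothesis b_surj : forall i w, exists z, b i z = w.

Let ba i z : b i.+1 (a i z) = 0.
Proof. by apply/ab_exact; exists z. Qed.

Lemma connecting_cocycle i (y : D i) :
  dE i (b i y) = 0 -> exists u : cocycle dC i, a i (val u) = dD i y.
Proof.
rewrite db => /ab_exact[u uE].
have /mk_cocycle[w wE] : dC i u = 0.
  by apply: (@a_inj i.+1); rewrite -da -uE dDD raddf0.
by exists w; rewrite wE.
Qed.

Lemma long_exact_sequence :
  exists (aS : forall i, {additive cohom dC i -> cohom dD i.+1})
         (bS : forall i, {additive cohom dD i -> cohom dE i})
         (cS : forall i, {additive cohom dE i -> cohom dC i}),
     (forall i (z : cocycle dC i) (w : cocycle dD i.+1),
        val w = a i (val z) -> aS i (cohom_class z) = cohom_class w)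
     /\ (forall i (z : cocycle dD i) (w : cocycle dE i),
           val w = b i (val z) -> bS i (cohom_class z) = cohom_class w)
     /\ (forall i (z : cocycle dE i) (y : D i) (u : cocycle dC i),
           b i y = val z -> a i (val u) = dD i y ->
           cS i (cohom_class z) = cohom_class u)
     /\ injective (bS 0%N)
     /\ (forall i, exact_at (bS i) (cS i))
     /\ (forall i, exact_at (cS i) (aS i))
     /\ (forall i, exact_at (aS i) (bS i.+1)).
Proof.
have aT i (z : cocycle dC i) : exists w : cocycle dD i.+1, val w = a i (val z).
  by apply: mk_cocycle; rewrite da cocycleP raddf0.
have bT i (z : cocycle dD i) : exists w : cocycle dE i, val w = b i (val z).
  by apply: mk_cocycle; rewrite db cocycleP raddf0.
have cT i (z : cocycle dE i) : exists u : cocycle dC i,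
    exists2 y, b i y = val z & a i (val u) = dD i y.
  have [y yE] := b_surj (val z).
  have [|u uE] := @connecting_cocycle i y; first by rewrite yE cocycleP.
  by exists u, y.
have aS i : exists F : {additive cohom dC i -> cohom dD i.+1}, forall z w,
    val w = a i (val z) -> F (cohom_class z) = cohom_class w.
  apply: (cohom_map_of_rel (aT i)) => [z w z' w' zw zw'|z w ->].
    by rewrite !raddfB /= zw zw'.
  case: i z w => [|i] z w /=; first by move=> ->; exists 0; rewrite !raddf0.
  by move=> [c ->]; exists (a i c); rewrite da.
have bS i : exists F : {additive cohom dD i -> cohom dE i}, forall z w,
    val w = b i (val z) -> F (cohom_class z) = cohom_class w.
  apply: (cohom_map_of_rel (bT i)) => [z w z' w' zw zw'|z w ->].
    by rewrite !raddfB /= zw zw'.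
  case: i z w => [|i] z w /=; first by move=> ->; rewrite raddf0.
  by move=> [c ->]; exists (b i c); rewrite db.
have cS i : exists F : {additive cohom dE i -> cohom dC i}, forall z u,
    (exists2 y, b i y = val z & a i (val u) = dD i y) ->
    F (cohom_class z) = cohom_class u.
  apply: (cohom_map_of_rel (cT i)).
    move=> z u z' u' [y yz yu] [y' yz' yu']; exists (y - y').
      by rewrite !raddfB /= yz yz'.
    by rewrite !raddfB /= yu yu'.
  move=> z u [y <- yu].
  (* In degree 0 a coboundary is 0, so [y] vanishes because [b 0] is injective. In higher degrees
     [y] differs from a coboundary by some [a i c], and then [u] is the coboundary of [c]. *)
  case: i z u y yu => [|i] z u y yu /=.
    move=> by0; apply: (@a_inj 0); rewrite yu.
    by have -> : y = 0; [apply: b0_inj; rewrite by0 raddf0 | rewrite !raddf0].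
  move=> [x]; have [y' <-] := b_surj x; rewrite db => /eqP.
  rewrite -subr_eq0 -raddfB => /eqP/ab_exact[c cE]; exists c.
  apply: (@a_inj i.+1); rewrite yu -da -cE raddfB /=.
  by rewrite dDD subr0.
exists (fun i => sval (cid (aS i))), (fun i => sval (cid (bS i))).
exists (fun i => sval (cid (cS i))).
have aSE i (z : cocycle dC i) (w : cocycle dD i.+1) : val w = a i (val z) ->
  sval (cid (aS i)) (cohom_class z) = cohom_class w by case: cid => F /= /[apply].
have bSE i (z : cocycle dD i) (w : cocycle dE i) : val w = b i (val z) ->
  sval (cid (bS i)) (cohom_class z) = cohom_class w by case: cid => F /= /[apply].
have cSE i (z : cocycle dE i) (y : D i) (u : cocycle dC i) :
    b i y = val z -> a i (val u) = dD i y ->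
    sval (cid (cS i)) (cohom_class z) = cohom_class u.
  by move=> yz yu; case: cid => F /=; apply; exists y.
do 3!split=> //.
split.
  apply: raddf_inj => x; elim/cohom_classW: x => z.
  have [w wE] := bT 0 z; rewrite (bSE _ _ _ wE) => /cohom_class_eq0.
  rewrite wE /= => bz; apply/cohom_class_eq0 => /=.
  by apply: b0_inj; rewrite bz raddf0.
split=> [i x|].
  split=> [|[{}x ->]].
    elim/cohom_classW: x => z; have [u [y yz yu]] := cT i z.
    rewrite (cSE _ _ _ _ yz yu) => /cohom_class_eq0 uB.
    (* It is enough to lift [z] to a cocycle. If [u] is the coboundary of [c], then [y - a i c] is
       such a lift; in degree 0, [u] is 0 and [y] itself is one. *)
    suff [y' yz' dy'] : exists2 y', b i y' = val z & dD i y' = 0.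
      have [w wE] := mk_cocycle dy'; exists (cohom_class w).
      by rewrite (bSE _ _ z) // wE.
    case: i z u y yz yu uB => [|i] z u y yz yu /=.
      by move=> u0; exists y => //; rewrite -yu /= u0 raddf0.
    move=> [c uE]; exists (y - a i c); first by rewrite raddfB /= ba subr0.
    by rewrite raddfB /= da -uE -yu subrr.
  elim/cohom_classW: x => z; have [w wE] := bT i z.
  rewrite (bSE _ _ _ wE) (cSE i w (val z) 0) //; last first.
    by rewrite cocycleP !raddf0.
  by apply/cohom_class_eq0; apply: coboundary0.
split=> [i x|i x].
  split=> [|[{}x ->]].
    elim/cohom_classW: x => u; have [w wE] := aT i u.
    (* A primitive [y] of [a i (val u)] is exactly the middle element of the zigzag that defines
       [cS] on the class of [b i y]. *)
    rewrite (aSE _ _ _ wE) => /cohom_class_eq0 /=; rewrite wE => -[y yE].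
    have [|z zE] := @mk_cocycle _ dE i (b i y); first by rewrite db -yE ba.
    by exists (cohom_class z); rewrite (cSE _ _ y u).
  elim/cohom_classW: x => z; have [u [y yz yu]] := cT i z.
  rewrite (cSE _ _ _ _ yz yu); have [w wE] := aT i u.
  rewrite (aSE _ _ _ wE); apply/cohom_class_eq0; rewrite wE.
  by exists y.
split=> [|[{}x ->]].
  elim/cohom_classW: x => z; have [w wE] := bT i.+1 z.
  rewrite (bSE _ _ _ wE) => /cohom_class_eq0 /=; rewrite wE => -[x].
  have [y <-] := b_surj x; rewrite db => /eqP.
  rewrite -subr_eq0 -raddfB => /eqP/ab_exact[c cE].
  have /mk_cocycle[u uE] : dC i c = 0.
    apply: (@a_inj i.+1); rewrite -da -cE raddfB /= dDD cocycleP.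
    by rewrite subr0 raddf0.
  exists (cohom_class u); have [w' wE'] := aT i u.
  rewrite (aSE _ _ _ wE'); apply/cohom_class_eq; rewrite wE' uE -cE.
  by exists y; rewrite opprB addrC subrK.
elim/cohom_classW: x => z; have [w wE] := aT i z.
have [v vE] := bT i.+1 w.
rewrite (aSE _ _ _ wE) (bSE _ _ _ vE); apply/cohom_class_eq0.
by rewrite vE wE ba; apply: coboundary0.
Qed.

End LongExactSequence.

(** * Components and Betti numbers when an edge is added *)

Section Components.
Variables (T : finType) (n : nat) (G : mgraph T n).
Implicit Types (s : {set 'I_n}) (f : 'I_n) (x y : T) (K : {set T}).

Lemma ends_vert f : f \in gedge G ->
  (gends G f).1 \in gvert G /\ (gends G f).2 \in gvert G.
Proof. by move=> fG; apply/andP; apply: (forall_inP (gendsP G)). Qed.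

Lemma connect_subC s : connect_sym (sub_adj G s).
Proof.
by apply: sym_connect_sym => x y; apply: eq_existsb => f; rewrite orbC.
Qed.

Lemma connect_sub_mono s s' : s \subset s' ->
  subrel (connect (sub_adj G s)) (connect (sub_adj G s')).
Proof.
move=> /subsetP ss'; apply: connect_sub => x y /exists_inP[f fs fE].
by apply: connect1; apply/exists_inP; exists f => //; apply: ss'.
Qed.

(** A path that uses f repeatedly can be shortened to use it at most once, in one of its two
    directions. *)
Lemma connect_setU1 s f x y (u := (gends G f).1) (v := (gends G f).2) :
  connect (sub_adj G (f |: s)) x y =
  [|| connect (sub_adj G s) x y,
      connect (sub_adj G s) x u && connect (sub_adj G s) v y
    | connect (sub_adj G s) x v && connect (sub_adj G s) u y].
Proof.
have uvE : gends G f = (u, v) by rewrite /u /v; case: (gends G f).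
have uv : connect (sub_adj G (f |: s)) u v.
  by apply: connect1; apply/exists_inP; exists f; rewrite ?setU11 ?uvE ?eqxx.
have vu : connect (sub_adj G (f |: s)) v u by rewrite connect_subC.
have sub := connect_sub_mono (subsetUr [set f] s).
apply/idP/or3P => [/connectP[p]|]; last first.
  case=> [/sub//|/andP[/sub xu /sub vy]|/andP[/sub xv /sub uy]].
    exact: connect_trans xu (connect_trans uv vy).
  exact: connect_trans xv (connect_trans vu uy).
elim: p x => [|z p IHp] x /= => [_ ->|/andP[/exists_inP[g]]].
  by constructor 1.
move=> /setU1P[->|gs] gE zp yE; last first.
  have xz : connect (sub_adj G s) x z.
    by apply: connect1; apply/exists_inP; exists g.
  by rewrite !(same_connect (@connect_subC s) xz); apply: IHp.
move: gE; rewrite uvE; clearbody u v.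
case/orP=> /eqP[? ?]; subst; case: (IHp _ zp (erefl _)) => [cy|/andP[_ cy]|/andP[_ cy]].
- by constructor 2; rewrite connect0.
- by constructor 2; rewrite connect0.
- by constructor 1.
- by constructor 3; rewrite connect0.
- by constructor 1.
- by constructor 3; rewrite connect0.
Qed.

(** This is literally the block of x in [equivalence_partition], so that components can be handled
    through a base vertex. *)
Definition component_of s x : {set T} := [set y in gvert G | connect (sub_adj G s) x y].

Lemma compsP s K :
  reflect (exists2 x, x \in gvert G & K = component_of s x) (K \in comps G s).
Proof. exact: imsetP. Qed.

Lemma component_of_in s x : x \in gvert G -> component_of s x \in comps G s.
Proof. by move=> xG; apply/compsP; exists x. Qed.

Lemma eq_component_of s x y : x \in gvert G -> y \in gvert G ->
  (component_of s x == component_of s y) = connect (sub_adj G s) x y.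
Proof.
move=> xG yG; apply/eqP/idP => [/setP/(_ y)|xy].
  by rewrite !inE yG connect0.
apply/setP => z; rewrite !inE.
by rewrite (same_connect (@connect_subC s) xy).
Qed.

(** Components of [G : s'] are unions of components of [G : s], so one base vertex decides the
    inclusion. This turns the inclusions that index the sums in [merge_A] into equalities. *)
Lemma sub_component_of s s' x K : s \subset s' -> x \in gvert G -> K \in comps G s' ->
  (component_of s x \subset K) = (K == component_of s' x).
Proof.
move=> ss' xG /compsP[y yG ->]; rewrite eq_component_of //.
have sub := connect_sub_mono ss'.
apply/subsetP/idP => [yx|yx z].
  by have := yx x; rewrite !inE xG connect0; apply.
rewrite !inE => /andP[-> /sub]; exact: connect_trans.
Qed.

Lemma component_of_setU1 s f x (u := (gends G f).1) (v := (gends G f).2) :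
  x \in gvert G -> f \in gedge G ->
  component_of (f |: s) x =
    if x \in component_of s u :|: component_of s v
    then component_of s u :|: component_of s v else component_of s x.
Proof.
move=> xG fG; apply/setP => y.
case: ifP; rewrite !inE connect_setU1 -/u -/v xG /=; last first.
  by rewrite !(connect_subC s _ x) => /norP[/negPf-> /negPf->]; rewrite !orbF.
rewrite -andb_orr => uvx; case: (y \in gvert G) => //=.
case/orP: uvx => cx; rewrite -!(same_connect (@connect_subC s) cx) connect0 /=.
  by case: (connect _ u y); rewrite ?orbT // andbF orbF.
by case: (connect _ v y); rewrite ?orbT // andbF orbF.
Qed.

Lemma comps_setU1_joined s f : ~~ joins_distinct G s f ->
  comps G (f |: s) = comps G s.
Proof.
rewrite negbK => uv; apply: eq_imset => x; apply/setP => y.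
rewrite !inE connect_setU1; congr (_ && _).
rewrite !(connect_subC s x (gends G f).1) !(connect_subC s x (gends G f).2).
rewrite -!(same_connect (@connect_subC s) uv) orbb.
apply: orb_idr => /andP[ux uy].
by rewrite -(same_connect (@connect_subC s) ux).
Qed.

Lemma b0_setU1 s f : f \in gedge G ->
  (b0 G (f |: s) + joins_distinct G s f)%N = b0 G s.
Proof.
move=> fG; case: (boolP (joins_distinct G s f)) => [uv|/comps_setU1_joined]; last first.
  by rewrite /b0 addn0 => ->.
have [uG vG] := ends_vert fG.
set u := (gends G f).1 in uG *; set v := (gends G f).2 in vG *.
have neq : component_of s v != component_of s u.
  by rewrite eq_component_of // connect_subC.
have -> : b0 G (f |: s) = #|component_of s u :|: component_of s v
    |: (comps G s :\ component_of s u :\ component_of s v)|.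
  congr #|pred_of_set _|; apply/setP => K; apply/compsP/setU1P => [[x xG ->]|].
    rewrite component_of_setU1 // -/u -/v; case: ifPn => [_|]; first by left.
    rewrite !inE xG /= => /norP[ux vx]; right.
    by rewrite component_of_in // !(eq_sym (component_of s x)) !eq_component_of // ux vx.
  case=> [->|/setD1P[Kv /setD1P[Ku /compsP[x xG KE]]]].
    by exists u => //; rewrite component_of_setU1 // -/u -/v !inE uG connect0.
  exists x => //; rewrite component_of_setU1 // -/u -/v ifN // !inE xG /=.
  by rewrite -!eq_component_of // -KE !(eq_sym _ K) negb_or Ku.
(* The two components at the ends of f are replaced by their union. The union is new: a component of
   [G : s] containing both ends would connect them without f. *)
have nin : component_of s u :|: component_of s v
    \notin comps G s :\ component_of s u :\ component_of s v.
  apply/negP => /setD1P[_ /setD1P[_ /compsP[x xG /setP E]]].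
  have := E u; have := E v; rewrite !inE uG vG !connect0 orbT /=.
  move=> /esym xv /esym xu; move: uv; rewrite /joins_distinct -/u -/v.
  by rewrite -(same_connect (@connect_subC s) xu) xv.
rewrite cardsU1 nin /b0 addnC addnA.
rewrite (cardsD1 (component_of s u) (comps G s)) component_of_in //.
by rewrite (cardsD1 (component_of s v) (comps G s :\ _)) !inE neq component_of_in.
Qed.

Lemma b0_set0 : b0 G set0 = #|gvert G|.
Proof.
rewrite /b0; have -> : comps G set0 = set1 @: gvert G.
  apply: eq_in_imset => x xG; apply/setP => y; rewrite !inE.
  apply/andP/eqP => [[_ /connectP[[|z p] //= /andP[/exists_inP[f]]]]|->].
    by rewrite inE.
  by rewrite connect0.
exact/card_imset/set1_inj.
Qed.

(** Equality holds for the empty edge set, and each edge lowers [b0] by at most one. This makes the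
    truncated subtraction in [b1] exact. *)
Lemma card_gvert_le s : s \subset gedge G -> (#|gvert G| <= #|s| + b0 G s)%N.
Proof.
move Ek: #|s| => k; elim: k s Ek => [|k IHk] s Ek sG.
  by rewrite (cards0_eq Ek) b0_set0.
have /card_gt0P[f fs] : (0 < #|s|)%N by rewrite Ek.
have fG := subsetP sG f fs.
have /IHk : #|s :\ f| = k by move: Ek; rewrite (cardsD1 f) fs => -[].
move=> /(_ (subset_trans (subsetDl _ _) sG)) /leq_trans-> //.
rewrite -[in b0 G s](setD1K fs) -(b0_setU1 (s :\ f) fG) addSnnS leq_add2l addnC.
by case: joins_distinct.
Qed.

Lemma b1_setU1 s f : s \subset gedge G -> f \in gedge G -> f \notin s ->
  b1 G (f |: s) = (b1 G s + ~~ joins_distinct G s f)%N.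
Proof.
move=> sG fG fs; rewrite /b1 cardsU1 fs -(b0_setU1 s fG).
have := card_gvert_le sG; rewrite -(b0_setU1 s fG).
case: joins_distinct; rewrite /= !(addn0, addn1, add1n, addSn, addnS) => // le.
by rewrite subSn.
Qed.

(* Each component of [G : s] lies in exactly one component of [G : s']. *)
Lemma sum_comps_comps s s' s'' (X : {set T} -> nat) K :
    s \subset s' -> s' \subset s'' -> K \in comps G s'' ->
  (\sum_(K' in comps G s' | K' \subset K)
     \sum_(K0 in comps G s | K0 \subset K') X K0 =
   \sum_(K0 in comps G s | K0 \subset K) X K0)%N.
Proof.
move=> ss' ss'' KG.
rewrite (exchange_big_dep [pred K0 | (K0 \in comps G s) && (K0 \subset K)]) /=.
  apply: eq_bigr => _ /andP[/compsP[x xG ->] xK].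
  rewrite (big_pred1 (component_of s' x)) // => K' /=; rewrite component_of_in //=.
  apply/andP/eqP => [[/andP[K'G _]]|->].
    by rewrite (sub_component_of ss') // => /eqP.
  rewrite component_of_in // (sub_component_of ss'') //.
  rewrite (sub_component_of ss') ?component_of_in // eqxx.
  by rewrite (sub_component_of (subset_trans ss' ss'')) // in xK.
by move=> K' K0 /andP[_ K'K] /andP[-> /subset_trans->].
Qed.

End Components.

(** * Basis vectors and push-forward of exponents *)

Section BasisVectors.
Variables (T : finType) (n : nat).
Implicit Types (G : mgraph T n) (s : {set 'I_n}) (f : 'I_n) (K : {set T}).

Lemma supp_sub G i (t : cbasis G i) : supp t \subset gedge G.
Proof. by case/andP: (valP t). Qed.

Lemma card_supp G i (t : cbasis G i) : #|supp t| = i.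
Proof. by case/andP: (valP t) => _ /eqP. Qed.

Lemma size_yexp G i (t : cbasis G i) : size (yexp t) = b1 G (supp t).
Proof. exact: size_tuple. Qed.

(* Extending exponents by [false] to all sets of vertices lets us compare basis
   vectors with different supports without dependent types. *)
Definition ext_exp G s (m : {ffun component G s -> bool}) K : bool :=
  if insub K is Some c then m c else false.

Definition factor G i (t : cbasis G i) : {set T} -> bool := ext_exp (xexp t).

Lemma ext_expE G s (m : {ffun component G s -> bool}) (c : component G s) :
  ext_exp m (val c) = m c.
Proof. by rewrite /ext_exp valK. Qed.

Lemma factorE G i (t : cbasis G i) (c : component G (supp t)) :
  factor t (val c) = xexp t c.
Proof. exact: ext_expE. Qed.

(** With [basis_inj], this replaces the dependent encoding by three independent data: support,
    exponents of x on the components, list of exponents of y. *)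
Lemma mk_basis G i s (X : {set T} -> bool) (y : seq bool) :
    s \subset gedge G -> #|s| = i -> size y = b1 G s ->
  exists t : cbasis G i,
    [/\ supp t = s, {in comps G s, factor t =1 X} & yexp t = y].
Proof.
move=> sG si /eqP ys.
pose m : mono G s := ([ffun c : component G s => X (val c)], Tuple ys).
have tP : (s \subset gedge G) && (#|s| == i) by rewrite sG si eqxx.
pose t : cbasis G i := Sub (Tagged (mono G) m) tP.
exists t; split=> // K KG.
by rewrite -[K]/(val (Sub K KG : component G s)) (@factorE _ _ t) ffunE.
Qed.

Lemma basis_inj G i (t t' : cbasis G i) :
    supp t = supp t' -> {in comps G (supp t), factor t =1 factor t'} ->
    yexp t = yexp t' -> t = t'.
Proof.
case: t t' => [[s [x y]] p] [[s' [x' y']] p'].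
rewrite /supp /= => ss'; subst s' => xx' /val_inj yy'; apply: val_inj => /=.
suff xE : x = x' by move: xx' yy'; rewrite /yexp /= xE => _ ->.
apply/ffunP => c; have := xx' (val c) (valP c).
by rewrite /factor !ext_expE.
Qed.

(** The relation [merge_A] freed from dependent types: only the values of [X] on [S] and of [X'] on
    [S'] matter. *)
Definition pushes (S S' : {set {set T}}) (X X' : {set T} -> bool) : bool :=
  [forall K' in S', (\sum_(K in S | K \subset K') X K)%N == X' K' :> nat].

Lemma merge_AE G s s' (m : {ffun component G s -> bool})
    (m' : {ffun component G s' -> bool}) :
  merge_A m m' = pushes (comps G s) (comps G s') (ext_exp m) (ext_exp m').
Proof.
have sumE K : (\sum_(c : component G s | val c \subset K) m c =
               \sum_(K0 in comps G s | K0 \subset K) ext_exp m K0)%N.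
  rewrite [RHS](reindex_omap (val : component G s -> _) insub) => /=.
    apply: eq_big => [c|c _]; last by rewrite ext_expE.
    by rewrite valK eqxx andbT (valP c).
  by move=> K0 /andP[K0G _]; rewrite insubT.
apply/forallP/forall_inP => mm' => [K KG|c'].
  have := mm' (Sub K KG); rewrite sumE.
  by rewrite -(ext_expE m').
by rewrite sumE -(ext_expE m') mm' // (valP c').
Qed.

Lemma merge_xexpE G i j (t : cbasis G i) (t' : cbasis G j) :
  merge_A (xexp t) (xexp t') =
  pushes (comps G (supp t)) (comps G (supp t')) (factor t) (factor t').
Proof. exact: merge_AE. Qed.

(** Coefficient of the map attached to a whole inclusion of supports: multiply the merged A factors
    and append as many 1's as [b1] grows. No order of the added edges enters. *)
Definition cob_coef G i j (t : cbasis G i) (t' : cbasis G j) : bool :=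
  pushes (comps G (supp t)) (comps G (supp t')) (factor t) (factor t') &&
  (yexp t' == yexp t ++ nseq (b1 G (supp t') - b1 G (supp t)) false).

(** Since [b1] grows by one exactly when f joins a component to itself, the case distinction in
    [edge_coef] is absorbed by the number of appended 1's. *)
Lemma edge_coefE G i f (t : cbasis G i) (t' : cbasis G i.+1) :
    f \in gedge G -> f \notin supp t ->
  edge_coef f t t' = (supp t' == f |: supp t) && cob_coef t t'.
Proof.
move=> fG ft; rewrite /edge_coef /cob_coef merge_xexpE.
case: eqP => //= t's; rewrite [in b1 G (supp t')]t's b1_setU1 ?supp_sub // addKn.
by case: joins_distinct; rewrite /= ?cats0 ?cats1.
Qed.

Lemma pushes_comp G s s' s'' (X X' X'' : {set T} -> bool) :
    s \subset s' -> s' \subset s'' ->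
    pushes (comps G s) (comps G s') X X' ->
  pushes (comps G s') (comps G s'') X' X'' =
  pushes (comps G s) (comps G s'') X X''.
Proof.
move=> ss' ss'' /forall_inP XX'; apply: eq_forallb_in => K KG.
congr (_ == _ :> nat); rewrite -(sum_comps_comps _ ss' ss'' KG).
by apply: eq_bigr => K' /andP[/XX'/eqP].
Qed.

Lemma eq_pushes (S S' : {set {set T}}) (X X' Y Y' : {set T} -> bool) :
  {in S, X =1 Y} -> {in S', X' =1 Y'} -> pushes S S' X X' = pushes S S' Y Y'.
Proof.
move=> XY XY'; apply: eq_forallb_in => K KS; rewrite XY' //.
by congr (_ == _); apply: eq_bigr => K' /andP[/XY->].
Qed.

(* If [X''] is the push-forward of [X], then [X] has degree at most 1 on every
   component of the intermediate graph, so its push-forward there exists. *)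
Lemma pushes_factor G s s' s'' (X X'' : {set T} -> bool)
    (X' := fun K' => (0 < \sum_(K in comps G s | K \subset K') X K)%N) :
    s \subset s' -> s' \subset s'' ->
  pushes (comps G s) (comps G s') X X' && pushes (comps G s') (comps G s'') X' X'' =
  pushes (comps G s) (comps G s'') X X''.
Proof.
move=> ss' s's''; apply/andP/idP => [[p1 p2]|p].
  by rewrite -(pushes_comp _ ss' s's'' p1).
suff p1 : pushes (comps G s) (comps G s') X X'.
  by split=> //; rewrite (pushes_comp _ ss' s's'' p1).
apply/forall_inP => K' K'G; rewrite /X'.
suff : (\sum_(K in comps G s | K \subset K') X K <= 1)%N.
  by case: (\sum_(_ in _ | _) _)%N => [|[]].
have /compsP[x xG K'E] := K'G.
have KG := component_of_in s'' xG.
have /forall_inP/(_ _ KG)/eqP := p; rewrite -(sum_comps_comps _ ss' s's'' KG).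
rewrite (bigD1 K') /=; last by rewrite K'G K'E (sub_component_of s's'') ?eqxx.
move=> E; have := leq_b1 (X'' (component_of G s'' x)); rewrite -E.
by apply: leq_trans; apply: leq_addr.
Qed.

(** At most one intermediate vector contributes: its support, exponents and list are all forced by
    [t] and f. *)
Lemma sum_edge_coef G i f g (t : cbasis G i) (t'' : cbasis G i.+2) :
    f \in gedge G -> f \notin supp t -> g \in gedge G -> g \notin f |: supp t ->
  (\sum_(t' : cbasis G i.+1) (edge_coef f t t')%:R * (edge_coef g t' t'')%:R =
   ((supp t'' == g |: (f |: supp t)) && cob_coef t t'')%:R :> int).
Proof.
move=> fG ft gG gt.
pose s' := f |: supp t.
have s'G : s' \subset gedge G by rewrite subUset sub1set fG supp_sub.
have ss' : supp t \subset s' := subsetUr _ _.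
(* Capping the exponents at 1 yields a candidate vector even when the product is 0; its coefficient
   is then 0, and [pushes_factor] makes the right-hand side 0 as well. *)
pose X' K' := (0 < \sum_(K in comps G (supp t) | K \subset K') factor t K)%N.
pose y' := yexp t ++ nseq (b1 G s' - b1 G (supp t)) false.
have b1s' : b1 G s' = (b1 G (supp t) + ~~ joins_distinct G (supp t) f)%N.
  by rewrite b1_setU1 ?supp_sub.
have [||t0 [t0s t0x t0y]] := @mk_basis G i.+1 s' X' y' s'G.
- by rewrite cardsU1 ft card_supp.
- by rewrite size_cat size_nseq size_yexp b1s' addKn.
have y'E : y' == yexp t ++ nseq (b1 G s' - b1 G (supp t)) false by [].
clearbody y'.
have t0P t' : edge_coef f t t' -> t' = t0.
  rewrite edge_coefE // /cob_coef => /and3P[/eqP t's tt' /eqP t'y].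
  apply: basis_inj; [by rewrite t0s | | by rewrite t0y (eqP y'E) t'y t's].
  rewrite t's => K KG.
  rewrite t0x // /X'; move: tt'; rewrite t's => /forall_inP/(_ K KG)/eqP->.
  by case: factor.
rewrite (bigD1 t0) //= big1 ?addr0 => [|t' t't0]; last first.
  by case: (boolP (edge_coef f t t')) => [/t0P/eqP|]; rewrite ?(negPf t't0) ?mul0r.
rewrite -natrM mulnb edge_coefE // edge_coefE ?t0s // eqxx /=.
congr (nat_of_bool _)%:R; case: eqP => [t''s|]; last by rewrite !andbF.
have b1s'' : b1 G (supp t'') = (b1 G s' + ~~ joins_distinct G s' g)%N.
  by rewrite t''s b1_setU1.
have s's'' : s' \subset supp t'' by rewrite t''s subsetUr.
have yE : (yexp t'' == y' ++ nseq (b1 G (supp t'') - b1 G s') false) =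
          (yexp t'' == yexp t ++ nseq (b1 G (supp t'') - b1 G (supp t)) false).
  rewrite (eqP y'E) -catA -nseqD; congr (_ == _ ++ nseq _ _).
  by rewrite b1s'' addKn b1s' -addnA !addKn.
have tt0E : cob_coef t t0 = pushes (comps G (supp t)) (comps G s') (factor t) X'.
  rewrite -(eq_pushes (in1W (frefl (factor t))) t0x) /cob_coef t0s t0y.
  by apply: andb_idr.
have t0t''E : cob_coef t0 t'' =
    pushes (comps G s') (comps G (supp t'')) X' (factor t'') &&
    (yexp t'' == yexp t ++ nseq (b1 G (supp t'') - b1 G (supp t)) false).
  rewrite -yE -(eq_pushes t0x (in1W (frefl (factor t'')))).
  by rewrite /cob_coef t0s t0y.
have XE := @pushes_factor G _ _ _ (factor t) (factor t'') ss' s's''.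
by rewrite -/X' in XE; rewrite tt0E t0t''E andTb andbA XE.
Qed.

(** * Signs and the vanishing of the squared differential *)

Lemma edge_sign_setU1 s f g : f \notin s ->
  edge_sign (f |: s) g = edge_sign s g * (-1) ^+ (f < g)%N.
Proof.
move=> fs; rewrite /edge_sign -exprD; congr (_ ^+ _); rewrite addnC.
have [fg|gf] := ltnP f g.
  have -> : [set k in f |: s | (k < g)%N] = f |: [set k in s | (k < g)%N].
    by apply/setP => k; rewrite !inE andb_orl; case: eqP => // ->; rewrite fg.
  by rewrite cardsU1 inE (negPf fs).
congr #|pred_of_set _|; apply/setP => k; rewrite !inE.
by case: eqP => // ->; rewrite (negPf fs) ltnNge gf.
Qed.

Lemma edge_sign_swap s f g : f \notin s -> g \notin s -> f != g ->
  edge_sign s f * edge_sign (f |: s) g = - (edge_sign s g * edge_sign (g |: s) f).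
Proof.
move=> fs gs; rewrite !edge_sign_setU1 // -val_eqE neq_ltn => fg.
suff -> : (-1) ^+ (f < g)%N = - (-1) ^+ (g < f)%N :> int.
  by rewrite !mulrN mulrCA.
by case: ltngtP fg; rewrite ?opprK ?expr1 ?expr0.
Qed.

Lemma diff_complex G : is_complex (diff G).
Proof.
move=> i z; apply/ffunP => t''; rewrite !ffunE.
under eq_bigr do rewrite ffunE mulr_suml.
rewrite exchange_big big1 //= => t _.
under eq_bigr do rewrite -mulrA.
rewrite -mulr_sumr; apply/eqP; rewrite mulf_eq0; apply/orP; right; apply/eqP.
pose P := [pred f | (f \in gedge G) && (f \notin supp t)].
(* The zero diagonal lets both indices run over the same set [P], so exchanging the sums swaps f and
   g. Antisymmetry then makes the total its own opposite, hence 0 in the integers. *)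
pose W f g := if f == g then 0 else
  edge_sign (supp t) f * edge_sign (f |: supp t) g *
    ((supp t'' == g |: (f |: supp t)) && cob_coef t t'')%:R.
suff -> : \sum_t' diff_coef t t' * diff_coef t' t'' = \sum_(f | P f) \sum_(g | P g) W f g.
  have WN f g : P f -> P g -> W f g = - W g f.
    move=> /andP[_ fs] /andP[_ gs]; rewrite /W [g == f]eq_sym.
    case: eqVneq => [|fg]; first by rewrite oppr0.
    by rewrite edge_sign_swap // mulNr setUCA.
  apply/eqP; rewrite -eqNr {1}exchange_big -sumrN; apply/eqP/eq_bigr => f Pf.
  by rewrite -sumrN; apply: eq_bigr => g Pg; rewrite [in RHS]WN.
transitivity (\sum_(t' : cbasis G i.+1) \sum_(f | P f) \sum_(g | P g && (g != f))
    edge_sign (supp t) f * edge_sign (f |: supp t) g *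
      ((edge_coef f t t')%:R * (edge_coef g t' t'')%:R)).
  apply: eq_bigr => t' _; rewrite mulr_suml; apply: eq_bigr => f _.
  case: (boolP (edge_coef f t t')) => [/and3P[/eqP t's _ _]|_]; last first.
    by rewrite mulr0 mul0r big1 // => g _; rewrite mul0r mulr0.
  rewrite mulr1 mulr_sumr; apply: eq_big => [g|g _].
    by rewrite t's !inE negb_or /= -andbA [(g != f) && _]andbC.
  by rewrite t's mul1r mulrA.
rewrite exchange_big; apply: eq_bigr => f /andP[fG fs]; rewrite exchange_big /=.
rewrite [RHS](bigID (fun g => g != f)) /= [X in _ + X]big1 ?addr0; last first.
  by move=> g /andP[_ /negPn/eqP->]; rewrite /W eqxx.
apply: eq_bigr => g /andP[/andP[gG gs] gf].
rewrite -mulr_sumr /W eq_sym (negPf gf); congr (_ * _).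
by rewrite sum_edge_coef // !inE negb_or gf.
Qed.

End BasisVectors.

(** This transfers the sum in a differential from one basis to another, for [h] the inclusion of the
    vectors avoiding e, or of those containing e. *)
Lemma sum_codom (I J : finType) (h : I -> J) (F : J -> int) :
    injective h -> (forall j, F j != 0 -> exists i, j = h i) ->
  \sum_j F j = \sum_i F (h i).
Proof.
move=> h_inj Fh; rewrite (bigID [in codom h]) /= [X in _ + X]big1 ?addr0 => [|j].
  transitivity (\sum_(j <- codom h) F j); last by rewrite big_image.
  by rewrite -big_uniq // map_inj_uniq ?enum_uniq.
by apply: contraNeq => /Fh[i ->]; apply: codom_f.
Qed.

(** Supports only grow, so the vectors containing e span a subcomplex, the one that [beta] kills and
    [alpha] parametrizes. *)
Lemma diff_coef_supp (T : finType) (n : nat) (G : mgraph T n) i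
    (t : cbasis G i) (t' : cbasis G i.+1) :
  diff_coef t t' != 0 -> supp t \subset supp t'.
Proof.
apply: contra_neqT => tt'; apply: big1 => f _.
case: (boolP (edge_coef f t t')) => [/and3P[/eqP t'E _ _]|]; last by rewrite mulr0.
by rewrite t'E subsetUr in tt'.
Qed.

(** * The map [beta] as restriction to basis vectors avoiding e *)

Section Deletion.
Variables (T : finType) (n : nat) (G : mgraph T n) (e : 'I_n).

Lemma undel_subproof i (t : cbasis (gdel G e) i) :
  (tag (val t : {s : {set 'I_n} & mono G s}) \subset gedge G) && (#|tag (val t)| == i).
Proof.
case/andP: (valP t) => /= tG ->; rewrite andbT.
exact: subset_trans tG (subsetDl _ _).
Qed.

Definition undel i (t : cbasis (gdel G e) i) : cbasis G i :=
  Sub (val t : {s : {set 'I_n} & mono G s}) (undel_subproof t).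

Lemma undel_inj i : injective (@undel i).
Proof. by move=> t t' /(congr1 val) tt'; apply: val_inj. Qed.

Lemma undel_supp i (t : cbasis (gdel G e) i) : e \notin supp (undel t).
Proof.
apply/negP => et; have := subsetP (supp_sub t) e et.
by rewrite !inE eqxx.
Qed.

Lemma undel_surj i (t : cbasis G i) : e \notin supp t -> exists t', t = undel t'.
Proof.
move=> et.
have tP : (tag (val t : {s : {set 'I_n} & mono (gdel G e) s}) \subset gedge (gdel G e))
    && (#|tag (val t)| == i).
  by case/andP: (valP t) => tG ti; rewrite ti andbT; apply/subsetD1P; split.
exists (Sub (val t : {s : {set 'I_n} & mono (gdel G e) s}) tP).
exact: val_inj.
Qed.

Lemma betaE i (z : chain G i) t : beta G e i z t = z (undel t).
Proof.
rewrite ffunE (bigD1 (undel t)) //= eqxx mulr1 big1 ?addr0 // => t' t't.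
rewrite (_ : _ == _ = false) ?mulr0 //.
by apply: contraNF t't => /eqP tt'; apply/eqP/val_inj.
Qed.

Lemma merge_undel i j (t : cbasis (gdel G e) i) (t' : cbasis (gdel G e) j) :
  merge_A (xexp (undel t)) (xexp (undel t')) = merge_A (xexp t) (xexp t').
Proof. by rewrite !merge_xexpE; reflexivity. Qed.

Lemma yexp_undel i (t : cbasis (gdel G e) i) : yexp (undel t) = yexp t.
Proof. exact: erefl. Qed.

Lemma edge_coef_undel i f (t : cbasis (gdel G e) i) (t' : cbasis (gdel G e) i.+1) :
  edge_coef f t t' = edge_coef f (undel t) (undel t').
Proof. by rewrite /edge_coef merge_undel !yexp_undel; reflexivity. Qed.

Lemma diff_coef_undel i (t : cbasis (gdel G e) i) (t' : cbasis (gdel G e) i.+1) :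
  diff_coef t t' = diff_coef (undel t) (undel t').
Proof.
(* The differential of G has one more edge to add, namely e, but its target would contain e, unlike
   [undel t']. *)
rewrite [RHS](bigID (fun f => f == e)) /= [X in _ = X + _]big1 => [|f].
  rewrite add0r; apply: eq_big => [f|f _].
    by rewrite !inE; case: (f == e); rewrite ?andbT ?andbF.
  by rewrite edge_coef_undel.
case/andP=> /andP[_ _] /eqP->; rewrite (_ : edge_coef e _ _ = false) ?mulr0 //.
by apply: contraNF (undel_supp t') => /and3P[/eqP t's _ _]; rewrite t's setU11.
Qed.

Lemma beta_diff i (z : chain G i) :
  diff (gdel G e) i (beta G e i z) = beta G e i.+1 (diff G i z).
Proof.
apply/ffunP => t'; rewrite betaE !ffunE [RHS](sum_codom (@undel_inj i)) => [|t].
  by apply: eq_bigr => t _; rewrite betaE diff_coef_undel.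
rewrite mulf_eq0 negb_or => /andP[_ /diff_coef_supp tt']; apply: undel_surj.
exact: contraNN (subsetP tt' e) (undel_supp t').
Qed.

Lemma beta_surj i (w : chain (gdel G e) i) : exists z, beta G e i z = w.
Proof.
exists [ffun t => if [pick t' | undel t' == t] is Some t' then w t' else 0].
apply/ffunP => t; rewrite betaE ffunE; case: pickP => [t' /eqP/undel_inj->//|].
by move=> /(_ t); rewrite eqxx.
Qed.

Lemma beta_eq0 i (z : chain G i) :
  beta G e i z = 0 <-> forall t, e \notin supp t -> z t = 0.
Proof.
split=> [/ffunP z0 _ /undel_surj[t ->]|z0].
  by rewrite -betaE z0 ffunE.
by apply/ffunP => t; rewrite betaE ffunE z0 ?undel_supp.
Qed.

Lemma beta0_inj : injective (beta G e 0).
Proof.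
apply: raddf_inj => z /beta_eq0 z0; apply/ffunP => t; rewrite ffunE z0 //.
by rewrite (cards0_eq (card_supp t)) inE.
Qed.

End Deletion.

(** * The loop e and the map [alpha] *)

Section Loop.
Variables (T : finType) (n : nat) (G : mgraph T n) (e : 'I_n).
Hypotheses (eG : e \in gedge G) (loop_e : is_loop G e).
Let H := gcontract G e.

(** Both ends of e coincide, so [contract_vertex] is the identity and the two records differ only in
    a proof of a boolean. *)
Lemma gcontract_loop : gdel G e = gcontract G e.
Proof.
have cvE v : contract_vertex G e v = v.
  by rewrite /contract_vertex; case: eqP => // ->; apply/eqP.
have vE : contract_vertex G e @: gvert G = gvert G.
  by rewrite -[RHS]imset_id; apply: eq_imset.
have endsE : contract_ends G e = gends G.
  by apply/ffunP => f; rewrite ffunE !cvE; case: (gends G f).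
rewrite /gdel /gcontract; move: (gdel_subproof G e) (gcontract_subproof G e).
by rewrite vE endsE => p q; congr MGraph; apply: bool_irrelevance.
Qed.

Lemma loop_not_distinct s : ~~ joins_distinct G s e.
Proof. by rewrite negbK (eqP loop_e) connect0. Qed.

Lemma comps_gcontract s : comps H s = comps G (e |: s).
Proof. by rewrite /H -gcontract_loop (comps_setU1_joined (loop_not_distinct s)). Qed.

Lemma joins_distinct_gcontract s f : joins_distinct G (e |: s) f = joins_distinct H s f.
Proof.
rewrite /H -gcontract_loop /joins_distinct connect_setU1 (eqP loop_e).
rewrite orbb; congr (~~ _); apply: orb_idr => /andP[]; exact: connect_trans.
Qed.

Lemma b1_gcontract (s : {set 'I_n}) : s \subset gedge G -> e \notin s ->
  b1 G (e |: s) = (b1 H s).+1.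
Proof.
by move=> sG es; rewrite b1_setU1 // loop_not_distinct addn1 /H -gcontract_loop.
Qed.

Lemma supp_gcontract i (t : cbasis H i) :
  [/\ supp t \subset gedge G, e \notin supp t & b1 G (e |: supp t) = (b1 H (supp t)).+1].
Proof.
have /subsetD1P[sG es] := supp_sub t; split=> //.
by rewrite b1_gcontract.
Qed.

(** Unsigned [alpha] on basis vectors. The next lemmas show that it is the graph of a bijection onto
    the vectors whose support contains e. *)
Definition alpha_rel i (t : cbasis H i * bool) (t' : cbasis G i.+1) : Prop :=
  [/\ supp t' = e |: supp t.1,
      {in comps G (supp t'), factor t' =1 factor t.1}
    & yexp t' = rcons (yexp t.1) t.2].

Lemma alpha_coefP i (t : cbasis H i * bool) (t' : cbasis G i.+1) :
  reflect (alpha_rel t t') (alpha_coef t t').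
Proof.
apply: (iffP and3P) => [[/eqP t's /forallP tt' /eqP t'y]|[t's tt' t'y]].
  split=> // K KG; have KH := KG; rewrite t's -comps_gcontract in KH.
  have /forallP/(_ (Sub K KG : component G _)) := tt' (Sub K KH : component H _).
  by move=> /implyP/(_ (eqxx _))/eqP; rewrite -!factorE.
split; [exact/eqP| |exact/eqP].
apply/forallP => c; apply/forallP => c'; apply/implyP => /eqP cc'.
by rewrite -!factorE cc' tt' ?(valP c').
Qed.

Lemma alpha_rel_total i (t : cbasis H i * bool) : exists t', alpha_rel t t'.
Proof.
have [sG es b1E] := supp_gcontract t.1.
have [|||t' [t's t'x t'y]] :=
  @mk_basis _ _ G i.+1 (e |: supp t.1) (factor t.1) (rcons (yexp t.1) t.2).
- by rewrite subUset sub1set eG.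
- by rewrite cardsU1 es card_supp.
- by rewrite size_rcons size_yexp b1E.
by exists t'; split=> //; rewrite t's.
Qed.

Lemma alpha_rel_surj i (t' : cbasis G i.+1) :
  e \in supp t' -> exists t : cbasis H i * bool, alpha_rel t t'.
Proof.
move=> et'; have t'E := setD1K et'.
have sH : supp t' :\ e \subset gedge H by apply: setSD; apply: supp_sub.
have b1E : b1 G (supp t') = (b1 H (supp t' :\ e)).+1.
  rewrite -[in LHS]t'E b1_gcontract ?inE ?eqxx //.
  exact: subset_trans (subsetDl _ _) (supp_sub t').
(* The list is not empty, since [b1] counts the loop e; its last entry becomes the exponent of the
   extra B factor. *)
move yE: (yexp t') (size_yexp t') => y'; case/lastP: y' yE => [|y b] yE.
  by rewrite b1E.
rewrite b1E size_rcons => -[ys].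
have [|t [ts tx ty]] := @mk_basis _ _ H i _ (factor t') y sH _ ys.
  by have := card_supp t'; rewrite (cardsD1 e) et' => -[].
exists (t, b); split; rewrite /= ?ts ?ty // => K KG.
by rewrite tx // comps_gcontract t'E.
Qed.

Lemma alpha_rel_fun i (t : cbasis H i * bool) t1 t2 :
  alpha_rel t t1 -> alpha_rel t t2 -> t1 = t2.
Proof.
move=> [s1 x1 y1] [s2 x2 y2].
apply: basis_inj => [|K KG|]; [exact: etrans s1 (esym s2) | | exact: etrans y1 (esym y2)].
by rewrite x1 // x2 // s2 -s1.
Qed.

Lemma alpha_rel_inj i (t1 t2 : cbasis H i * bool) t' :
  alpha_rel t1 t' -> alpha_rel t2 t' -> t1 = t2.
Proof.
case: t1 t2 => [t1 b1] [t2 b2] [s1 x1 y1] [s2 x2 y2] /=.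
move: y2; rewrite y1 => /rcons_inj[y12 ->]; congr (_, _).
have s12 : supp t1 = supp t2.
  have [_ e1 _] := supp_gcontract t1; have [_ e2 _] := supp_gcontract t2.
  by rewrite -(setU1K e1) -(setU1K e2) -s1 -s2.
apply: basis_inj => [|K KG|]; [exact: s12 | | exact: y12].
rewrite comps_gcontract -[e |: _]s1 in KG.
by rewrite -x1 // -x2.
Qed.

Lemma alphaE i (z : chainB H i) t t' : alpha_rel t t' ->
  alpha G e i z t' = alpha_sign (supp t.1) e * z t.
Proof.
move=> tt'; rewrite ffunE (bigD1 t) //= (introT (alpha_coefP t t') tt') mulr1 mulrC.
rewrite big1 ?addr0 // => t1 t1t.
case: (alpha_coefP t1 t') => [/(alpha_rel_inj tt') E|]; last by rewrite !mulr0.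
by rewrite E eqxx in t1t.
Qed.

Lemma alpha_out i (z : chainB H i) t' : e \notin supp t' -> alpha G e i z t' = 0.
Proof.
move=> et'; rewrite ffunE big1 // => t _.
case: (alpha_coefP t t') => [[t's _ _]|]; last by rewrite !mulr0.
by rewrite t's setU11 in et'.
Qed.

Lemma alpha_sign_setU1 (s : {set 'I_n}) (f : 'I_n) : f \notin s ->
  alpha_sign (f |: s) e = alpha_sign s e * (-1) ^+ (e < f)%N.
Proof.
move=> fs; rewrite /alpha_sign -exprD; congr (_ ^+ _); rewrite addnC.
have [ef|fe] := ltnP e f.
  have -> : [set k in f |: s | (e < k)%N] = f |: [set k in s | (e < k)%N].
    by apply/setP => k; rewrite !inE andb_orl; case: eqP => // ->; rewrite ef.
  by rewrite cardsU1 inE (negPf fs).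
congr #|pred_of_set _|; apply/setP => k; rewrite !inE.
by case: eqP => // ->; rewrite (negPf fs) ltnNge fe.
Qed.

(** When f closes a cycle, both sides append 1 after the extra exponent, which thus moves inside the
    list. This is why the differential on the tensor product is not [diff] tensored with the
    identity. *)
Lemma edge_coef_alpha i f (t1 : cbasis H i * bool) t1' (t2 : cbasis H i.+1 * bool) t2' :
    f != e -> alpha_rel t1 t1' -> alpha_rel t2 t2' ->
  edge_coef f t1' t2' = edge_coefB f t1 t2.
Proof.
move=> fe [s1 x1 y1] [s2 x2 y2]; rewrite /edge_coef /edge_coefB.
rewrite !merge_xexpE (eq_pushes x1 x2) !comps_gcontract -s1 -s2.
rewrite {3}s1 joins_distinct_gcontract y1 y2.
have [_ e1 _] := supp_gcontract t1.1; have [_ e2 _] := supp_gcontract t2.1.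
have -> : (supp t2' == f |: supp t1') = (supp t2.1 == f |: supp t1.1).
  rewrite s1 s2 setUCA; apply/eqP/eqP => [E|-> //].
  by rewrite -(setU1K e2) E setU1K // !inE negb_or eq_sym fe.
by case: joins_distinct => //; rewrite eqseq_rcons.
Qed.

(** Having e in the support multiplies the sign of f by -1 when e < f; adding f to the support
    multiplies [alpha_sign] by the same factor. *)
Lemma diff_coef_alpha i (t1 : cbasis H i * bool) t1' (t2 : cbasis H i.+1 * bool) t2' :
    alpha_rel t1 t1' -> alpha_rel t2 t2' ->
  alpha_sign (supp t1.1) e * diff_coef t1' t2' =
  alpha_sign (supp t2.1) e * diffB_coef t1 t2.
Proof.
move=> r1 r2; have [s1 _ _] := r1; have [_ e1 _] := supp_gcontract t1.1.
rewrite /diff_coef /diffB_coef !mulr_sumr; apply: eq_big => [f|f /andP[fG]].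
  by rewrite s1 !inE negb_or andbCA andbA.
rewrite s1 in_setU1 negb_or => /andP[fe fs].
rewrite (edge_coef_alpha fe r1 r2).
case: (boolP (edge_coefB f t1 t2)) => [/and3P[/eqP s12 _ _]|_]; last by rewrite !mulr0.
rewrite s12 !mulr1 edge_sign_setU1 // alpha_sign_setU1 //.
by rewrite mulrA mulrAC.
Qed.

Lemma alpha_diff i (z : chainB H i) :
  diff G i.+1 (alpha G e i z) = alpha G e i.+1 (diffB H i z).
Proof.
apply/ffunP => t2'; have [et2|et2] := boolP (e \in supp t2'); last first.
  rewrite alpha_out // ffunE big1 // => t1' _.
  have [et1|et1] := boolP (e \in supp t1'); last by rewrite alpha_out ?mul0r.
  apply/eqP; rewrite mulf_eq0; apply/orP; right.
  by apply: contraNT et2 => /diff_coef_supp/subsetP; apply.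
have [t2 r2] := alpha_rel_surj et2; rewrite (alphaE _ r2) !ffunE mulr_sumr.
(* The function [h] realizes the bijection. Vectors outside its image avoid e, and there [alpha]
   takes the value 0. *)
have [h hP] := choice (@alpha_rel_total i).
rewrite (@sum_codom _ _ h) => [|t t' tt'|t'].
- apply: eq_bigr => t _; rewrite (alphaE _ (hP t)) mulrAC (diff_coef_alpha (hP t) r2).
  by rewrite -mulrA [diffB_coef _ _ * _]mulrC.
- by apply: alpha_rel_inj (hP t) _; rewrite tt'.
rewrite mulf_eq0 negb_or => /andP[zt' _].
have [/alpha_rel_surj[t tt']|et'] := boolP (e \in supp t').
  by exists t; apply: alpha_rel_fun tt' (hP t).
by rewrite alpha_out ?eqxx in zt'.
Qed.

Lemma alpha_inj i : injective (alpha G e i).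
Proof.
move=> z w zw; apply/ffunP => t; have [t' tt'] := alpha_rel_total t.
have := congr1 (fun v : chain G i.+1 => v t') zw.
by rewrite /= !(alphaE _ tt') => /mulfI; apply; rewrite signr_eq0.
Qed.

(** The control on the zeros of the preimage makes one construction serve both exactness and
    surjectivity onto each summand. *)
Lemma alpha_onto i (v : chain G i.+1) : (forall t, e \notin supp t -> v t = 0) ->
  exists2 u : chainB H i, v = alpha G e i u &
    forall t t', alpha_rel t t' -> v t' = 0 -> u t = 0.
Proof.
move=> v0; have [h hP] := choice (@alpha_rel_total i).
exists [ffun t => alpha_sign (supp t.1) e * v (h t)].
  apply/ffunP => t'; have [/alpha_rel_surj[t tt']|et'] := boolP (e \in supp t').
    by rewrite (alphaE _ tt') ffunE signrMK (alpha_rel_fun tt' (hP t)).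
  by rewrite v0 // alpha_out.
by move=> t t' tt' vt'; rewrite ffunE -(alpha_rel_fun tt' (hP t)) vt' mulr0.
Qed.

Lemma alpha_beta_exact i : exact_at (alpha G e i) (beta G e i.+1).
Proof.
move=> v; rewrite beta_eq0; split=> [/alpha_onto[u -> _]|[u ->] t]; first by exists u.
exact: alpha_out.
Qed.

Lemma alpha_summand i (s : {set 'I_n}) (z : chainB H i) :
  in_summandB s z -> in_summand (e |: s) (alpha G e i z).
Proof.
move=> zs t' t's; have [/alpha_rel_surj[t tt']|et'] := boolP (e \in supp t').
  rewrite (alphaE _ tt') zs ?mulr0 //; case: tt' t's => -> _ _.
  by apply: contraNneq => ->.
exact: alpha_out.
Qed.

Lemma alpha_summand_onto i (s : {set 'I_n}) (w : chain G i.+1) :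
    s \subset gedge H -> in_summand (e |: s) w ->
  exists! z : chainB H i, in_summandB s z /\ alpha G e i z = w.
Proof.
move=> /subsetD1P[_ es] ws.
have [t et|u wE u0] := @alpha_onto i w.
  by apply: ws; apply: contraNneq et => ->; rewrite setU11.
exists u; split=> [|u' [_ u'E]]; last by apply: alpha_inj; rewrite u'E.
split=> // t ts; have [t' tt'] := alpha_rel_total t; apply: (u0 t t' tt') (ws _ _).
have [t's _ _] := tt'; have [_ et _] := supp_gcontract t.1.
apply: contraNneq ts; rewrite t's => E.
by rewrite -(setU1K et) E setU1K.
Qed.

(** Inherited from G: [alpha] intertwines the differentials and is injective, so no second sign
    computation is required. *)
Lemma diffB_complex : is_complex (diffB H).
Proof.
by move=> i z; apply: alpha_inj; rewrite -!alpha_diff raddf0 diff_complex.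
Qed.

End Loop.

Theorem theorem5p4 (T : finType) (n : nat) (G : mgraph T n) (e : 'I_n)
    (eG : e \in gedge G) (loop_e : is_loop G e) :
  gdel G e = gcontract G e
  (* (a) *)
  /\ [/\ is_complex (diff G), is_complex (diff (gdel G e))
       & is_complex (diffB (gcontract G e))]
  /\ (forall i (z : chainB (gcontract G e) i),
        diff G i.+1 (alpha G e i z) = alpha G e i.+1 (diffB (gcontract G e) i z))
  /\ (forall i (z : chain G i),
        diff (gdel G e) i (beta G e i z) = beta G e i.+1 (diff G i z))
  /\ (forall i (s : {set 'I_n}), s \subset gedge (gcontract G e) ->
        (forall z, in_summandB s z -> in_summand (e |: s) (alpha G e i z))
        /\ (forall w, in_summand (e |: s) w ->
              exists! z, in_summandB s z /\ alpha G e i z = w))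
  /\ injective (beta G e 0%N)
  /\ (forall i, injective (alpha G e i))
  /\ (forall i, exact_at (alpha G e i) (beta G e i.+1))
  /\ (forall i (w : chain (gdel G e) i), exists z, beta G e i z = w)
  (* (b) *)
  /\ exists (alphaS : forall i, {additive cohom (diffB (gcontract G e)) i ->
                                          cohom (diff G) i.+1})
            (betaS : forall i, {additive cohom (diff G) i ->
                                         cohom (diff (gdel G e)) i})
            (gammaS : forall i, {additive cohom (diff (gdel G e)) i ->
                                          cohom (diffB (gcontract G e)) i}),
     (forall i (z : cocycle (diffB (gcontract G e)) i)
             (w : cocycle (diff G) i.+1),
        val w = alpha G e i (val z) ->
        alphaS i (cohom_class z) = cohom_class w)
     /\ (forall i (z : cocycle (diff G) i) (w : cocycle (diff (gdel G e)) i),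
           val w = beta G e i (val z) ->
           betaS i (cohom_class z) = cohom_class w)
     (* gammaS is the connecting homomorphism *)
     /\ (forall i (z : cocycle (diff (gdel G e)) i) (y : chain G i)
                (u : cocycle (diffB (gcontract G e)) i),
           beta G e i y = val z -> alpha G e i (val u) = diff G i y ->
           gammaS i (cohom_class z) = cohom_class u)
     /\ injective (betaS 0%N)
     /\ (forall i, exact_at (betaS i) (gammaS i))
     /\ (forall i, exact_at (gammaS i) (alphaS i))
     /\ (forall i, exact_at (alphaS i) (betaS i.+1)).
Proof.
split; first exact: gcontract_loop.
split.
  split; [exact: diff_complex|exact: diff_complex|exact: diffB_complex].
split; first exact: alpha_diff.
split; first exact: beta_diff.
split.
  by move=> i s sH; split=> [z|w]; [apply: alpha_summand | apply: alpha_summand_onto].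
split; first exact: beta0_inj.
split; first exact: alpha_inj.
split; first exact: alpha_beta_exact.
split; first exact: beta_surj.
apply: long_exact_sequence.
- exact: diff_complex.
- exact: alpha_diff.
- exact: beta_diff.
- exact: beta0_inj.
- exact: alpha_inj.
- exact: alpha_beta_exact.
- exact: beta_surj.
Qed.
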